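(* Suppose the sequence $(c_n)_{n\ge0}$ satisfies $$(n+1)^3(3n+4)(3n+7)\,c_n+(2n+3)(3n+1)(3n+7)(5n^2+15n+12)\,c_{n+1}+16(n+2)^3(3n+1)(3n+4)\,c_{n+2}=0 .$$ Then the substitution $$u_n=\frac{(-32)^n}{3n+1}\,c_n$$ transforms this recurrence into the Domb number recurrence (OEIS A002895; case $(\alpha)$ in the Almkvist–Zudilin/Delaygue classification) $$(n+1)^3u_{n+1}=2(2n+1)(5n^2+5n+2)\,u_n-64n^3\,u_{n-1}.$$
   Context: The first recurrence is that of the kernel operator $L_2^{(2)}$ of the second order-$3$ recurrence for $\pi$ printed in Appendix B.6 of Raz et al. The recurrence for $(c_n)$ is imposed for $n\ge0$, and the resulting recurrence for $(u_n)$ is for $n\ge1$. *)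

(* Defs.v *)
From mathcomp Require Import all_boot all_order all_algebra.

Set Implicit Arguments.
Unset Strict Implicit.
Unset Printing Implicit Defensive.

Import Order.TTheory GRing.Theory Num.Theory.

Local Open Scope ring_scope.

(* The recurrence of the kernel operator $L_2^{(2)}$ of Raz et al. *)
Definition kernel_recurrence (F : numFieldType) (c : nat -> F) : Prop :=
  forall n : nat,
    (n%:R + 1) ^+ 3 * (3 * n%:R + 4) * (3 * n%:R + 7) * c n
    + (2 * n%:R + 3) * (3 * n%:R + 1) * (3 * n%:R + 7)
      * (5 * n%:R ^+ 2 + 15 * n%:R + 12) * c n.+1
    + 16 * (n%:R + 2) ^+ 3 * (3 * n%:R + 1) * (3 * n%:R + 4) * c n.+2 = 0.

(* The recurrence satisfied by the Domb numbers (OEIS A002895). *)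
Definition domb_recurrence (F : numFieldType) (u : nat -> F) : Prop :=
  forall n : nat, (1 <= n)%N ->
    (n%:R + 1) ^+ 3 * u n.+1
    = 2 * (2 * n%:R + 1) * (5 * n%:R ^+ 2 + 5 * n%:R + 2) * u n
      - 64 * n%:R ^+ 3 * u n.-1.

(* Main.v *)
Require Import Defs.
From mathcomp Require Import all_boot all_order all_algebra.
From mathcomp Require Import ring.

Set Implicit Arguments.
Unset Strict Implicit.
Unset Printing Implicit Defensive.

Import Order.TTheory GRing.Theory Num.Theory.

Local Open Scope ring_scope.

(** Writing c n = (3 n + 1) v n, each of the three terms of the kernel
    recurrence at n acquires the common factor (3 n + 1) (3 n + 4) (3 n + 7),
    and what remains is a recurrence for v whose coefficients are those of the
    Domb recurrence at n + 1 up to constants. The rescaling u n = (-32) ^ n v n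
    absorbs these constants: after multiplication by 64 (-32) ^ n, the
    coefficients 1, 1, 16 become 64, -2, 1, because 64 / (-32) = -2 and
    16 * 64 / (-32) ^ 2 = 1. So the defects of the two recurrences differ by a
    factor that never vanishes in characteristic 0
    ([kernel_domb_proportional]), and one is zero exactly when the other is. *)

Lemma mulrn_add_neq0 (F : numFieldType) (a b n : nat) :
  (0 < b)%N -> a%:R * n%:R + b%:R != 0 :> F.
Proof.
by move=> b_gt0; rewrite -natrM -natrD pnatr_eq0 -lt0n addn_gt0 b_gt0 orbT.
Qed.

(** The variables [x], [c0], [c1], [c2] and [p] stand for n, three consecutive
    values of c, and (-32) ^ n: the comparison of the two recurrences at a given
    index is an identity of rational functions. The Domb recurrence enters at
    index n + 1, hence the coefficients in x + 1. *)
Lemma kernel_domb_proportional (F : fieldType) (x c0 c1 c2 p : F) :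
    3 * x + 1 != 0 -> 3 * x + 4 != 0 -> 3 * x + 7 != 0 ->
  64 * p * ((x + 1) ^+ 3 * (3 * x + 4) * (3 * x + 7) * c0
    + (2 * x + 3) * (3 * x + 1) * (3 * x + 7)
      * (5 * x ^+ 2 + 15 * x + 12) * c1
    + 16 * (x + 2) ^+ 3 * (3 * x + 1) * (3 * x + 4) * c2)
  = (3 * x + 1) * (3 * x + 4) * (3 * x + 7)
    * ((x + 1 + 1) ^+ 3 * ((- 32) ^+ 2 * p / (3 * x + 7) * c2)
       - (2 * (2 * (x + 1) + 1) * (5 * (x + 1) ^+ 2 + 5 * (x + 1) + 2)
            * (- 32 * p / (3 * x + 4) * c1)
          - 64 * (x + 1) ^+ 3 * (p / (3 * x + 1) * c0))).
Proof. by move=> h1 h4 h7; field; rewrite h1 h4 h7. Qed.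

Theorem theorem4p3 (F : numFieldType) (c u : nat -> F)
    (hu : forall n : nat, u n = (- 32) ^+ n / (3 * n%:R + 1) * c n) :
  kernel_recurrence c <-> domb_recurrence u.
Proof.
have h1 n : 3 * n%:R + 1 != 0 :> F by apply: (@mulrn_add_neq0 F 3 1).
have h4 n : 3 * n%:R + 4 != 0 :> F by apply: (@mulrn_add_neq0 F 3 4).
have h7 n : 3 * n%:R + 7 != 0 :> F by apply: (@mulrn_add_neq0 F 3 7).
have pow_neq0 n : 64 * (- 32) ^+ n != 0 :> F.
  by rewrite mulf_neq0 ?expf_neq0 ?oppr_eq0 ?pnatr_eq0.
have hu1 n : u n.+1 = - 32 * (- 32) ^+ n / (3 * n%:R + 4) * c n.+1.
  by rewrite hu exprS; congr (_ / _ * _); rewrite -natr1; ring.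
have hu2 n : u n.+2 = (- 32) ^+ 2 * (- 32) ^+ n / (3 * n%:R + 7) * c n.+2.
  by rewrite hu -exprD; congr (_ / _ * _); rewrite -!natr1; ring.
have prop n := kernel_domb_proportional (c n) (c n.+1) (c n.+2) ((- 32) ^+ n)
  (h1 n) (h4 n) (h7 n).
split=> [hc [//|n] _ | hd n].
  have /esym/eqP := prop n.
  rewrite hc mulr0 !mulf_eq0 (negPf (h1 n)) (negPf (h4 n)) (negPf (h7 n)) /=.
  by rewrite subr_eq0 -hu -hu1 -hu2 -(natr1 n) => /eqP.
have := prop n; rewrite -hu -hu1 -hu2 (natr1 n) (hd n.+1 isT) subrr mulr0.
by move/eqP; rewrite mulf_eq0 (negPf (pow_neq0 n)) /= => /eqP.
Qed.
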